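(* Let $X$ be a finite dimensional normed space, let the set $Q$ be closed, and let the functions $f$ and $\|\varphi(\cdot)\|$ be lower semicontinuous on $Q$. Suppose also that $\mathcal{T} \subseteq K^*_{++}$. Then the penalty function $\Phi_{\tau}$ is globally exact if and only if the following two conditions hold: (1) $\Phi_{\tau}$ is locally exact at every globally optimal solution of the problem $(\mathcal{P})$; (2) there exists $\tau_0 \in \mathcal{T}$ such that the sublevel set $\{ x \in Q \mid \Phi_{\tau_0}(x) < f_* \}$ is either bounded or empty.
   Context: Setting. $X$ is equipped with the metric of its norm, $M, Q \subseteq X$ satisfy $M \cap Q \neq \emptyset$, and $f \colon X \to \mathbb{R} \cup \{+\infty\}$. Problem $(\mathcal{P})$: minimize $f(x)$ subject to $x \in M \cap Q$. It is assumed that $(\mathcal{P})$ has a globally optimal solution and that its optimal value $f_*$ is finite. $Y$ is a real normed space, $K \subset Y$ is a closed convex pointed cone ($K \cap (-K) = \{0\}$). An improper element $\infty$ is added to $Y$, with $\|\infty\| = +\infty$. $\varphi \colon X \to K \cup \{\infty\}$ is a function such that $\varphi(x) = 0$ iff $x \in M$. $Y^*$ is the topological dual, $\langle\cdot,\cdot\rangle$ is the duality pairing, $K^* = \{y^* \in Y^* : \langle y^*, y\rangle \ge 0 \ \forall y \in K\}$, and $K^*_+ = \{y^* \in K^* : \langle y^*, y \rangle > 0 \ \forall y \in K \setminus \{0\}\}$, assumed nonempty. $K^*_{++}$ is the set of all $\tau \in K^*_+$ for which there exists $c>0$ with $\langle \tau, y\rangle \ge c\|y\|$ for all $y \in K$.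 $\mathcal{T} \subset K^*_+$ is a fixed nonempty set with $\alpha\tau \in \mathcal{T}$ for all $\tau \in \mathcal{T}$, $\alpha>0$. For $\tau \in \mathcal{T}$, $\Phi_\tau(x) = f(x) + \langle \tau, \varphi(x)\rangle$, where $\langle \tau, \infty\rangle = +\infty$. Problem $(\mathcal{P}_\tau)$: minimize $\Phi_\tau(x)$ subject to $x \in Q$. Write $\tau \succeq_{K^*} \tau_*$ iff $\tau - \tau_* \in K^*$. Local exactness. If $x_*$ is a locally optimal solution of $(\mathcal{P})$, $\Phi_\tau$ is locally exact at $x_*$ if there is $\tau_* \in \mathcal{T}$ such that for all $\tau \in \mathcal{T}$ with $\tau \succeq_{K^*} \tau_*$ the point $x_*$ is a locally optimal solution of $(\mathcal{P}_\tau)$. Global exactness. $\Phi_\tau$ is globally exact if there is $\tau_* \in \mathcal{T}$ such that for all $\tau \in \mathcal{T}$ with $\tau \succeq_{K^*} \tau_*$ the set of globally optimal solutions of $(\mathcal{P})$ coincides with the set of globally optimal solutions of $(\mathcal{P}_\tau)$. *)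

(* Defs.v *)
From HB Require Import structures.
From mathcomp Require Import all_boot all_order all_algebra.
From mathcomp Require Import all_classical all_reals all_analysis.

Set Implicit Arguments.
Unset Strict Implicit.
Unset Printing Implicit Defensive.

Import Order.TTheory GRing.Theory Num.Theory.
Import numFieldNormedType.Exports.

Local Open Scope classical_set_scope.
Local Open Scope ring_scope.

Definition finite_dimensional (R : realType) (X : lmodType R) : Prop :=
  exists n : nat, inhabited (Vector.axiom n X).

(* Points outside Q are isolated in [subspace Q], so this is lower
   semicontinuity of the restriction of g to Q. *)
Definition lower_semicontinuous_on (R : realType) (X : topologicalType)
    (Q : set X) (g : X -> \bar R) : Prop :=
  lower_semicontinuous (g : subspace Q -> \bar R).

Section Cones.
Context (R : realType) (Y : normedModType R).
Implicit Types (K : set Y) (t : Y -> R^o).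

Definition closed_convex_pointed_cone K : Prop :=
  [/\ closed K, convex_set K,
      (forall (a : R) y, 0 <= a -> K y -> K (a *: y)) &
      K `&` [set - y | y in K] = [set 0]].

(* Functionals are kept as bare functions, so that sums, differences and scalar
   multiples in the dual are those of the pointwise lmodType [Y -> R^o]. *)
Definition topological_dual : set (Y -> R^o) :=
  [set t | linear t /\ continuous t].

Definition dual_cone K : set (Y -> R^o) :=
  [set t | topological_dual t /\ forall y, K y -> 0 <= t y].

Definition dual_cone_pos K : set (Y -> R^o) :=
  [set t | dual_cone K t /\ forall y, K y -> y != 0 -> 0 < t y].

Definition dual_cone_upos K : set (Y -> R^o) :=
  [set t | dual_cone_pos K t /\
    exists2 c : R, 0 < c & forall y, K y -> c * `|y| <= t y].

Definition dual_ge K t t' : Prop := dual_cone K (t - t').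

(* Here and below, [None : option Y] is the improper element adjoined to Y. *)
Definition ext_pairing t (z : option Y) : \bar R :=
  if z is Some y then (t y)%:E else +oo%E.

Definition ext_norm (z : option Y) : \bar R :=
  if z is Some y then `|y|%:E else +oo%E.

End Cones.

Section Optimization.
Context (R : realType) (X : topologicalType).
Implicit Types (A : set X) (g : X -> \bar R).

Definition global_solutions A g : set X :=
  [set x | A x /\ forall y, A y -> (g x <= g y)%E].

Definition local_solutions A g : set X :=
  [set x | A x /\ \forall y \near within A (nbhs x), (g x <= g y)%E].

Definition optimal_value A g : \bar R := ereal_inf [set g x | x in A].

End Optimization.

Section Penalty.
Context (R : realType) (X : topologicalType) (Y : normedModType R).
Context (M Q : set X) (f : X -> \bar R).
Context (K : set Y) (phi : X -> option Y) (T : set (Y -> R^o)).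

Definition penalty (t : Y -> R^o) (x : X) : \bar R :=
  (f x + ext_pairing t (phi x))%E.

Definition locally_exact_at (x : X) : Prop :=
  exists2 t0, T t0 & forall t, T t -> dual_ge K t t0 ->
    local_solutions Q (penalty t) x.

Definition globally_exact : Prop :=
  exists2 t0, T t0 & forall t, T t -> dual_ge K t t0 ->
    global_solutions (M `&` Q) f = global_solutions Q (penalty t).

End Penalty.

(* Main.v *)
Require Import Defs.
From HB Require Import structures.
From mathcomp Require Import all_boot all_order all_algebra.
From mathcomp Require Import all_classical all_reals all_analysis.
From mathcomp Require Import lra.

Set Implicit Arguments.
Unset Strict Implicit.
Unset Printing Implicit Defensive.

Import Order.TTheory GRing.Theory Num.Theory.
Import numFieldNormedType.Exports.

Local Open Scope classical_set_scope.
Local Open Scope ring_scope.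

(** Global exactness at t forces local exactness above t, and it makes the
    sublevel set {x in Q | Phi_t x < f_*} empty, because the minimum of Phi_t
    over Q is then attained at a solution of the constrained problem, where
    Phi_t = f = f_*.

    Conversely, only the ray of multiples of the given t0 is needed. The heart
    is that Phi_(n+1)t0 >= f_* on Q for some n [exists_penalty_ge]. Otherwise,
    for each n some x_n in Q has Phi_(n+1)t0 (x_n) < f_*. As Phi increases with
    the multiplier, all x_n lie in the bounded sublevel set of Phi_t0, so in
    finite dimension they have a cluster point p. Near p the function f is
    bounded below, so (n+1) t0(phi x_n) stays bounded; since t0(y) >= c |y| on
    K, the norms |phi x_n| tend to 0 along the points x_n near p, and lower
    semicontinuity yields phi p = 0 and f p <= f_*. Thus p is a solution of the
    constrained problem [minimizing_sequence_cluster], and local exactness at p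
    provides some t1 above which p is a local minimizer. A large multiple of t0
    dominates t1, because t1 is bounded and t0 is uniformly positive
    [dual_ge_upos_scale]; hence Phi_(n+1)t0 >= f_* near p for large n, against
    the choice of the x_n.

    Once Phi_s >= f_* on Q, adding one more t0 to s turns the inequality into a
    strict one at infeasible points, and this separates the minimizers of the
    penalized problem from infeasible points [globally_exact_of_penalty_ge]. *)

(** * Compactness in finite-dimensional normed spaces *)

Lemma bounded_setP (R : realType) (V : normedModType R) (A : set V) :
  bounded_set A <-> exists M : R, forall x, A x -> `|x| <= M.
Proof.
split=> [/pinfty_ex_gt0[M _ HM]|[M HM]]; first by exists M.
exists M; split; first exact: num_real.
by move=> M' MM' x /HM xM; exact: le_trans xM (ltW MM').
Qed.

(** A linear map on row vectors is a finite sum of coordinates scaling the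
    images of the unit vectors, and coordinates are continuous. *)
Lemma linear_rV_continuous (R : realType) (n : nat) (V : normedModType R)
    (g : {linear 'rV[R]_n -> V}) : continuous g.
Proof.
have -> : (g : _ -> _) = fun u => \sum_(j < n) u 0 j *: g (delta_mx 0 j).
  apply/funext => u; rewrite [in LHS](row_sum_delta u) linear_sum.
  by apply: eq_bigr => j _; rewrite linearZ.
apply: continuous_big => [|j _ v]; first exact: add_continuous.
have coord_j : continuous (fun M : 'rV[R]_n => M 0 j).
  exact: coord_continuous.
by apply: (@cvgZr_tmp _ _ _ (nbhs v) _ (fun M : 'rV[R]_n => M 0 j));
  exact: coord_j.
Qed.

(** Half of the equivalence of norms in finite dimension: the constant is the
    minimum of |g v| over the compact unit sphere, which is nonzero by
    injectivity. *)
Lemma injective_linear_rV_bounded_below (R : realType) (n : nat)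
    (V : normedModType R) (g : {linear 'rV[R]_n -> V}) :
  injective g -> exists2 c : R, 0 < c & forall v, c * `|v| <= `|g v|.
Proof.
move=> g_inj; pose S := [set v : 'rV[R]_n | `|v| = 1].
have unit_S v : v != 0 -> S (`|v|^-1 *: v).
  by move=> v0; rewrite /S/= normrZ normfV normr_id mulVf ?normr_eq0.
(* The sphere is empty exactly when n = 0; then every vector is 0. *)
have [S0|/set0P S0] := eqVneq S set0.
  exists 1 => // v; have [->|/unit_S] := eqVneq v 0.
    by rewrite normr0 mulr0.
  by rewrite S0.
have cS : compact S.
  apply: bounded_closed_compact; first by apply/bounded_setP; exists 1 => v ->.
  apply: (@preimage_closed _ _ (fun v : 'rV[R]_n => `|v|) [set x : R | x = 1]).
    by move=> v _; exact: norm_continuous.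
  exact: closed_eq.
have [|v0 /set_mem Sv0 v0_min] :=
    @compact_EVT_min _ _ (fun v => `|g v|) S S0 cS.
  apply: continuous_subspaceT => v.
  apply: continuous_comp; first exact: linear_rV_continuous.
  exact: norm_continuous.
exists `|g v0|.
  rewrite normr_gt0; apply: contra_eq_neq Sv0 => gv0.
  have -> : v0 = 0 by apply: g_inj; rewrite gv0 linear0.
  by rewrite normr0 eq_sym oner_eq0.
move=> v; have [->|v_neq0] := eqVneq v 0; first by rewrite normr0 mulr0.
have := v0_min _ (mem_set (unit_S _ v_neq0)).
by rewrite linearZ/= normrZ normfV normr_id mulrC ler_pdivlMr ?normr_gt0.
Qed.

(** Heine-Borel for an arbitrary norm: A is the continuous image of its
    coordinate set, which is closed by continuity and bounded by the lower
    bound on the inverse of the coordinate map. *)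
Lemma finite_dimensional_bounded_closed_compact (R : realType)
    (V : normedModType R) (A : set V) :
  finite_dimensional V -> bounded_set A -> closed A -> compact A.
Proof.
move=> [n [[h h_lin [g' hK gK]]]] /bounded_setP[M AM] clA.
have g_lin : linear g'.
  by move=> a u v; apply: (can_inj hK); rewrite gK h_lin !gK.
pose g : {linear 'rV[R]_n -> V} :=
  HB.pack g' (GRing.isLinear.Build _ _ _ _ g' g_lin).
have g_cont : continuous g by exact: linear_rV_continuous.
have [c c0 cg] := @injective_linear_rV_bounded_below _ _ _ g (can_inj gK).
have -> : A = g @` (g @^-1` A).
  apply/seteqP; split=> [x Ax|_ [v Av <-]//].
  by exists (h x) => //=; rewrite hK.
apply: continuous_compact; first exact: continuous_subspaceT.
apply: bounded_closed_compact.
  apply/bounded_setP; exists (M / c) => v /AM gvM.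
  by rewrite ler_pdivlMr// mulrC; exact: le_trans (cg v) gvM.
by apply: preimage_closed => // v _; exact: g_cont.
Qed.

(** * Functionals on the cone *)

Section Dual.
Context (R : realType) (Y : normedModType R) (K : set Y).
Implicit Types s t : Y -> R^o.

Lemma topological_dualZ (a : R) t :
  topological_dual t -> topological_dual (a *: t).
Proof.
move=> [t_lin t_cont]; split=> [b u v|y].
  by rewrite !fctE t_lin scalerDr !scalerA mulrC.
by apply: cvgZl_tmp; exact: t_cont.
Qed.

Lemma topological_dualB s t :
  topological_dual s -> topological_dual t -> topological_dual (s - t).
Proof.
move=> [s_lin s_cont] [t_lin t_cont]; split=> [b u v|y].
  by rewrite !fctE s_lin t_lin scalerBr opprD addrACA.
by apply: cvgB; [exact: s_cont|exact: t_cont].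
Qed.

Lemma topological_dual_bounded t : topological_dual t ->
  exists2 C : R, 0 < C & forall y, `|t y| <= C * `|y|.
Proof.
move=> [t_lin t_cont].
pose g : {linear Y -> R^o} := HB.pack t (GRing.isLinear.Build _ _ _ _ t t_lin).
have /linear_boundedP/pinfty_ex_gt0[C C0 HC] : bounded_near g (nbhs 0).
  by apply/linear_bounded_continuous; exact: t_cont.
by exists C.
Qed.

Lemma dual_cone_pos_at0 t : dual_cone_pos K t -> t 0 = 0.
Proof.
move=> [[[t_lin _] _] _].
by have := t_lin (-1) 0 0; rewrite scaler0 add0r scaleN1r addNr.
Qed.

Lemma dual_ge_scale (a b : R) t : dual_cone K t -> b <= a ->
  dual_ge K (a *: t) (b *: t).
Proof.
move=> [t_dual t_ge0] ba; split.
  by apply: topological_dualB; exact: topological_dualZ.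
by move=> y /t_ge0 ty; rewrite !fctE -scalerBl mulr_ge0 ?subr_ge0.
Qed.

(** Uniform positivity makes the ray of t cofinal for the dual order: with
    |s y| <= C |y| everywhere and c |y| <= t y on K, every a >= C / c works.
    Mere positivity of t would not provide such a C / c. *)
Lemma dual_ge_upos_scale s t : dual_cone_upos K t -> topological_dual s ->
  exists b : R, forall a, b <= a -> dual_ge K (a *: t) s.
Proof.
move=> [[[t_dual _] _] [c c0 ct]] s_dual.
have [C C0 sC] := topological_dual_bounded s_dual.
exists (C / c) => a; rewrite ler_pdivrMr// => Cac.
split; first by apply: topological_dualB => //; exact: topological_dualZ.
move=> y Ky; rewrite !fctE subr_ge0.
apply: le_trans (ler_norm _) (le_trans (sC y) _).
have a0 : 0 < a by move: (lt_le_trans C0 Cac); rewrite pmulr_lgt0.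
apply: (@le_trans _ _ (a * c * `|y|)); first exact: ler_wpM2r.
by rewrite -mulrA /GRing.scale/= ler_wpM2l ?ct// ltW.
Qed.

End Dual.

(** * The penalty function *)

Lemma global_solution_value (R : realType) (X : topologicalType) (A : set X)
    (g : X -> \bar R) x :
  global_solutions A g x -> g x = optimal_value A g.
Proof.
move=> [Ax x_min]; apply/eqP; rewrite eq_le; apply/andP; split.
  by apply: le_ereal_inf_tmp => _ [y /x_min gy <-].
by apply: ereal_inf_lbound; exists x.
Qed.

Section Penalty.
Context (R : realType) (X : topologicalType) (Y : normedModType R).
Context (f : X -> \bar R) (K : set Y) (phi : X -> option Y).
Hypothesis phiK : forall x y, phi x = Some y -> K y.
Implicit Types s t : Y -> R^o.

Lemma penalty_feasible t x : dual_cone_pos K t -> phi x = Some 0 ->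
  penalty f phi t x = f x.
Proof.
by move=> tK phix; rewrite /penalty phix/= (dual_cone_pos_at0 tK) adde0.
Qed.

Lemma penalty_ge t x : dual_cone_pos K t -> (f x <= penalty f phi t x)%E.
Proof.
move=> [[_ t_ge0] _]; rewrite leeDl// /ext_pairing.
case phix: (phi x) => [y|]; rewrite ?leey// lee_fin t_ge0//.
exact: phiK phix.
Qed.

Lemma penalty_le s t x : dual_ge K t s ->
  (penalty f phi s x <= penalty f phi t x)%E.
Proof.
move=> [_ ts]; rewrite leeD2l// /ext_pairing.
case phix: (phi x) => [y|]//; rewrite lee_fin -subr_ge0; apply: ts.
exact: phiK phix.
Qed.

(** At an infeasible point t pays a strictly positive amount, or +oo at the
    improper element; f x != -oo keeps it from being absorbed. *)
Lemma penalty_lt_add (v : R) s t x : dual_cone_pos K t -> phi x <> Some 0 ->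
  f x != -oo%E ->
  (v%:E <= penalty f phi s x)%E -> (v%:E < penalty f phi (s + t)%R x)%E.
Proof.
move=> [_ t_gt0] phix0 fx; rewrite /penalty /ext_pairing.
case phix: (phi x) => [y|]; last by rewrite addey// ltry.
have y0 : y != 0 by apply: contra_notN phix0 => /eqP <-; rewrite phix.
move: (t_gt0 _ (phiK phix) y0) fx => ty.
case: (f x) => [r| |]; [|by rewrite !addye// ltry|by rewrite eqxx].
by rewrite -!EFinD !lee_fin lte_fin fctE => _ vrs; lra.
Qed.

(** A small penalized value forces near-feasibility: with f bounded below by l,
    c |y| stays below (v - l) / a, so for c > 0 the norm of y vanishes as the
    multiple a of t grows. *)
Lemma penalized_infeasibility_lt (l v c a : R) t x y :
  phi x = Some y -> (l%:E <= f x)%E -> c * `|y| <= t y -> 0 <= a ->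
  (penalty f phi (a *: t)%R x < v%:E)%E -> a * (c * `|y|) < v - l.
Proof.
rewrite /penalty => -> /=.
case: (f x) => [r| |]; [|by rewrite addye|by rewrite leeNy_eq].
rewrite -EFinD lee_fin lte_fin fctE => lr cty a0 rv.
have : a * (c * `|y|) <= a * t y by rewrite ler_wpM2l.
by move: rv; rewrite /GRing.scale/=; lra.
Qed.

End Penalty.

(** * Lower semicontinuity and cluster points *)

Section LowerSemicontinuity.
Context (R : realType) (X : topologicalType) (Q : set X) (g : X -> \bar R).
Hypothesis g_lsc : lower_semicontinuous_on Q g.

Lemma lower_semicontinuous_on_near p (a : R) : Q p -> (a%:E < g p)%E ->
  \forall x \near p, Q x -> (a%:E < g x)%E.
Proof.
move=> Qp /(g_lsc (x := p))[V Vp Vg].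
have {}Vp : within Q (nbhs p) V by rewrite nbhs_subspace_in.
apply: (@filterS _ (nbhs p) _ (fun x => Q x -> V x)) Vp.
move=> x QV /QV; exact: Vg.
Qed.

End LowerSemicontinuity.

(** Replaces extraction of a convergent subsequence: every property valid near
    the cluster point holds for arbitrarily late terms. *)
Lemma cluster_sequence (X : topologicalType) (A : set X) (x_ : nat -> X) :
  compact A -> (forall n, A (x_ n)) ->
  exists p, A p /\ forall (P : set X) N, (\forall x \near p, P x) ->
    exists2 n, (N <= n)%N & P (x_ n).
Proof.
move=> cA Ax; have [|p [Ap clp]] := cA (x_ @ \oo) _ _.
  by exists 0%N => // n _; exact: Ax.
exists p; split=> // P N Pp.
have [|_ [[n Nn <-] Pn]] := clp [set x_ n | n in [set n | (N <= n)%N]] P _ Pp.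
  by exists N => // n Nn; exists n.
by exists n.
Qed.

(** * Global exactness from a lower bound on the penalty function *)

Section ExactnessFromLowerBound.
Context (R : realType) (X : topologicalType) (Y : normedModType R).
Context (M Q : set X) (f : X -> \bar R) (K : set Y) (phi : X -> option Y).
Context (T : set (Y -> R^o)) (v : R).
Hypothesis phiK : forall x y, phi x = Some y -> K y.
Hypothesis phiM : forall x, phi x = Some 0 <-> M x.
Hypothesis T_pos : T `<=` dual_cone_pos K.
Hypothesis f_neqNy : forall x, f x != -oo%E.
Context (x0 : X).
Hypothesis x0_sol : global_solutions (M `&` Q) f x0.
Hypothesis fx0 : f x0 = v%:E.

(** Phi_s >= v alone leaves open that an infeasible point attains the value v;
    the additional t excludes this for every multiplier above s + t. *)
Lemma globally_exact_of_penalty_ge (s t : Y -> R^o) :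
  dual_cone_pos K t -> T (s + t) ->
  (forall x, Q x -> (v%:E <= penalty f phi s x)%E) ->
  globally_exact M Q f K phi T.
Proof.
move=> tK Tst v_le; exists (s + t) => // u Tu ust.
have [[Mx0 Qx0] x0_min] := x0_sol; rewrite fx0 in x0_min.
have eq_M x : M x -> penalty f phi u x = f x.
  by move=> /phiM; exact: penalty_feasible (T_pos Tu).
have v_lt_u x : Q x -> ~ M x -> (v%:E < penalty f phi u x)%E.
  move=> Qx Mx; apply: lt_le_trans (penalty_le f phiK _ ust).
  by apply: (penalty_lt_add phiK tK) => [/phiM|//|]; last exact: v_le.
apply/seteqP; split=> x.
  move=> [[Mx Qx] x_min]; split=> // y Qy; rewrite eq_M//.
  apply: le_trans (x_min _ (conj Mx0 Qx0)) _; rewrite fx0.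
  have [My|/(v_lt_u _ Qy)/ltW//] := pselect (M y).
  by rewrite eq_M// x0_min.
move=> [Qx x_min].
have ux : (penalty f phi u x <= v%:E)%E by rewrite -fx0 -eq_M// x_min.
have Mx : M x.
  by apply: contrapT => /(v_lt_u _ Qx); rewrite ltNge ux.
split=> // y [My Qy]; rewrite -eq_M//; apply: le_trans ux _; exact: x0_min.
Qed.

End ExactnessFromLowerBound.

(** * The lower bound along the ray of one multiplier *)

Section LowerBound.
Context (R : realType) (X Y : normedModType R).
Context (M Q : set X) (f : X -> \bar R) (K : set Y) (phi : X -> option Y).
Context (T : set (Y -> R^o)) (v : R) (t0 : Y -> R^o).
Hypothesis phiK : forall x y, phi x = Some y -> K y.
Hypothesis phiM : forall x, phi x = Some 0 <-> M x.
Hypothesis T_upos : T `<=` dual_cone_upos K.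
Hypothesis T_scale : forall (t : Y -> R^o) (a : R), T t -> 0 < a -> T (a *: t).
Hypothesis f_neqNy : forall x, f x != -oo%E.
Hypothesis v_le : forall x, M x -> Q x -> (v%:E <= f x)%E.
Hypothesis X_fin : finite_dimensional X.
Hypothesis Q_closed : closed Q.
Hypothesis f_lsc : lower_semicontinuous_on Q f.
Hypothesis phi_lsc : lower_semicontinuous_on Q (fun x => ext_norm (phi x)).
Hypothesis Tt0 : T t0.
Hypothesis S_bounded :
  bounded_set [set x | Q x /\ (penalty f phi t0 x < v%:E)%E].
Hypothesis loc_exact :
  forall x, global_solutions (M `&` Q) f x -> locally_exact_at Q f K phi T x.

Let T_pos : T `<=` dual_cone_pos K.
Proof. by move=> t /T_upos[]. Qed.

(** Points that beat the value v under ever larger penalties accumulate at a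
    feasible point: boundedness provides the cluster point p, and since f
    cannot drop below some l near p, the growing penalty term pushes the
    infeasibility to 0. *)
Lemma minimizing_sequence_cluster (x_ : nat -> X) :
  (forall n, Q (x_ n)) ->
  (forall n, (penalty f phi (n.+1%:R *: t0) (x_ n) < v%:E)%E) ->
  exists p, (M `&` Q) p /\ (f p <= v%:E)%E /\
    forall (P : set X) N, (\forall x \near p, P x) ->
      exists2 n, (N <= n)%N & P (x_ n).
Proof.
move=> Qx x_lt.
have /bounded_setP[B SB] := S_bounded.
have x_B n : `|x_ n| <= B.
  apply: SB; split; first exact: Qx.
  apply: le_lt_trans (x_lt n); apply: (penalty_le f phiK).
  rewrite -[X in dual_ge _ _ X]scale1r; apply: dual_ge_scale.
    exact: (T_pos Tt0).1.
  by rewrite ler1n.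
have B_compact : compact [set x : X | `|x| <= B].
  apply: finite_dimensional_bounded_closed_compact => //.
    by apply/bounded_setP; exists B.
  apply: (@preimage_closed _ _ (fun x : X => `|x|) [set b : R | b <= B]).
    by move=> x _; exact: norm_continuous.
  exact: closed_le.
have [p [_ p_freq]] := cluster_sequence B_compact x_B.
have Qp : Q p.
  apply: Q_closed => U /(p_freq U 0%N)[n _ Un]; exists (x_ n); split=> //.
have fpv : (f p <= v%:E)%E.
  rewrite leNgt; apply/negP => /(lower_semicontinuous_on_near f_lsc Qp).
  move=> /(p_freq _ 0%N)[n _ /(_ (Qx n))]; apply/negP; rewrite -leNgt.
  apply: le_trans (ltW (x_lt n)); apply: (penalty_ge f phiK).
  by apply/T_pos/T_scale.
suff Mp : M p by exists p.
have [l lp] : exists l : R, (l%:E < f p)%E.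
  move: (f_neqNy p); case: (f p) => [r _|_|]; last by rewrite eqxx.
    by exists (r - 1); rewrite lte_fin ltrBlDr ltrDl.
  by exists 0; rewrite ltry.
apply/phiM; apply: contrapT => phip.
(* If p were infeasible, its infeasibility would exceed some e > 0, and by
   lower semicontinuity so would that of the x_n near p. *)
have [e e0 ep] : exists2 e : R, 0 < e & (e%:E < ext_norm (phi p))%E.
  move: phip; case: (phi p) => [y|] y0; last by exists 1; rewrite ?ltry.
  have {}y0 : 0 < `|y| by rewrite normr_gt0; apply: contra_notN y0 => /eqP->.
  by exists (`|y| / 2); rewrite ?divr_gt0//= lte_fin; lra.
have [_ [c c0 ct0]] := T_upos Tt0.
(* From this index on, an infeasibility above e alone costs more than v - l. *)
pose N := Num.truncn ((v - l) / (c * e)).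
have [n Nn [lx ex]] := p_freq _ N (filterI
  (lower_semicontinuous_on_near f_lsc Qp lp)
  (lower_semicontinuous_on_near phi_lsc Qp ep)).
have {}lx := lx (Qx n); have {}ex := ex (Qx n).
case phix : (phi (x_ n)) ex => [y|]/=; last first.
  by have := x_lt n; rewrite /penalty phix/= addey.
rewrite lte_fin => ey.
have := penalized_infeasibility_lt phix (ltW lx) (ct0 _ (phiK phix))
  (ler0n R n.+1) (x_lt n).
apply/negP; rewrite -leNgt.
apply: (@le_trans _ _ (n.+1%:R * (c * e))).
  rewrite -ler_pdivrMr ?mulr_gt0//.
  apply: (le_trans (ltW (truncnS_gt _))); by rewrite ler_nat.
by rewrite !ler_wpM2l// ?ltW.
Qed.

(** Local exactness is used at the cluster point of a sequence of
    counterexamples. The local minimality there is taken for one fixed multiple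
    N.+1 of t0, so that its neighborhood does not depend on n; monotonicity in
    the multiplier then transports it to the later terms. *)
Lemma exists_penalty_ge :
  exists n : nat, forall x, Q x -> (v%:E <= penalty f phi (n.+1%:R *: t0) x)%E.
Proof.
apply: contrapT => /forallNP no_n.
have /choice[x_ x_P] n :
    exists x, Q x /\ (penalty f phi (n.+1%:R *: t0) x < v%:E)%E.
  have /existsNP[x /not_implyP[Qx xv]] := no_n n.
  by exists x; split=> //; rewrite ltNge; exact/negP.
have Qx n := (x_P n).1; have x_lt n := (x_P n).2.
have [p [[Mp Qp] [fpv p_freq]]] := minimizing_sequence_cluster Qx x_lt.
have fp : f p = v%:E by apply/eqP; rewrite eq_le fpv v_le.
have p_sol : global_solutions (M `&` Q) f p.
  by split=> // y [My Qy]; rewrite fp v_le.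
have [t1 Tt1 t1P] := loc_exact p_sol.
have [b bP] := dual_ge_upos_scale (T_upos Tt0) (T_pos Tt1).1.1.
pose N := Num.truncn b.
have TN : T (N.+1%:R *: t0) by apply: T_scale.
have bN : b <= N.+1%:R by exact/ltW/truncnS_gt.
have [_ p_loc] := t1P _ TN (bP _ bN).
have [n Nn /(_ (Qx n))] := p_freq _ N p_loc.
rewrite (penalty_feasible f (T_pos TN)) ?fp; last exact/phiM.
apply/negP; rewrite -ltNge; apply: le_lt_trans (x_lt n).
apply: (penalty_le f phiK); apply: dual_ge_scale; last by rewrite ler_nat.
exact: (T_pos Tt0).1.
Qed.

End LowerBound.

Theorem theorem1 (R : realType) (X Y : normedModType R)
    (M Q : set X) (f : X -> \bar R)
    (K : set Y) (phi : X -> option Y) (T : set (Y -> R^o))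
    (hMQ : M `&` Q !=set0)
    (hf : forall x, f x != -oo%E)
    (hsol : global_solutions (M `&` Q) f !=set0)
    (hval : optimal_value (M `&` Q) f \is a fin_num)
    (hK : closed_convex_pointed_cone K)
    (hphiK : forall x y, phi x = Some y -> K y)
    (hphiM : forall x, phi x = Some 0 <-> M x)
    (hKpos : dual_cone_pos K !=set0)
    (hT0 : T !=set0)
    (hTpos : T `<=` dual_cone_pos K)
    (hTscale : forall (t : Y -> R^o) (a : R), T t -> 0 < a -> T (a *: t))
    (hX : finite_dimensional X)
    (hQ : closed Q)
    (hflsc : lower_semicontinuous_on Q f)
    (hphilsc : lower_semicontinuous_on Q (fun x => ext_norm (phi x)))
    (hTupos : T `<=` dual_cone_upos K) :
  globally_exact M Q f K phi T <->
  (forall x, global_solutions (M `&` Q) f x ->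
     locally_exact_at Q f K phi T x) /\
  (exists2 t0, T t0 &
     let S := [set x | Q x /\
                (penalty f phi t0 x < optimal_value (M `&` Q) f)%E] in
     bounded_set S \/ S = set0).
Proof.
have [x0 x0_sol] := hsol.
have [_ x0_min] := x0_sol.
have fx0 := global_solution_value x0_sol.
move: fx0; rewrite -(fineK hval); set v := fine _ => fx0.
have v_le x : M x -> Q x -> (v%:E <= f x)%E.
  by move=> Mx Qx; rewrite -fx0 x0_min.
split=> [[t Tt t_exact]|[loc_exact [t0 Tt0 S_bounded]]].
  split=> [x x_sol|].
    exists t => // u Tu ut; move: x_sol; rewrite (t_exact u)// => -[Qx x_min].
    by split=> //; apply: (@filterS _ _ _ Q) (withinT _ _) => y; exact: x_min.
  exists t => //; right; apply/seteqP; split=> // x [Qx].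
  have tt : dual_ge K t t.
    rewrite -[t]scale1r.
    by apply: dual_ge_scale => //; exact: (hTpos _ Tt).1.
  have px0 : penalty f phi t x0 = v%:E.
    rewrite (penalty_feasible f (hTpos _ Tt)) ?fx0//.
    by apply/hphiM; case: x0_sol => -[].
  move: x0_sol; rewrite (t_exact t Tt tt) => -[_ /(_ x Qx)].
  by rewrite px0 leNgt => /negP.
have {}S_bounded :
    bounded_set [set x | Q x /\ (penalty f phi t0 x < v%:E)%E].
  by case: S_bounded => [//|->]; apply/bounded_setP; exists 0.
have [n n_ge] := exists_penalty_ge hphiK hphiM hTupos hTscale hf v_le hX hQ
  hflsc hphilsc Tt0 S_bounded loc_exact.
apply: (globally_exact_of_penalty_ge hphiK hphiM hTpos hf x0_sol fx0
  (hTpos _ Tt0) _ n_ge).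
by rewrite -[X in _ + X]scale1r -scalerDl; apply: hTscale.
Qed.
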